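(* Let $G$ be a connected graph (possibly infinite) and let $r,v\in V(G)$. If $w\in\mathbb{R}_{\geq 0}^{V(G)}$ is edge-reachable from $\mathds{1}_{\{r\}}$, then \[ w(v)\leq \frac{1}{d_G(r,v)+1}. \]
   Context: A weight distribution on a graph $G$ is a function $w\in\mathbb{R}_{\geq 0}^{V(G)}$; for $S\subseteq V(G)$ write $w(S)=\sum_{x\in S}w(x)$. For $S\subseteq V(G)$, $\mathds{1}_S$ is the weight distribution with value $1$ on $S$ and $0$ elsewhere. For a finite nonempty set $T\subseteq V(G)$ inducing a connected subgraph, the sharing move on $T$ changes $w$ to $w'$ where $w'(x)=w(T)/|T|$ for $x\in T$ and $w'(x)=w(x)$ for $x\notin T$. An edge-sharing move is a sharing move on $T=\{x,y\}$ where $xy\in E(G)$. A weight distribution $w'$ is edge-reachable from $w$ if some finite sequence of edge-sharing moves changes $w$ to $w'$. $d_G(u,v)$ denotes the length of a shortest $u$–$v$ path in $G$. *)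

(* Defs.v *)
From mathcomp Require Import all_boot all_order all_algebra finmap.
From mathcomp Require Import boolp classical_sets reals numfun.

Set Implicit Arguments.
Unset Strict Implicit.
Unset Printing Implicit Defensive.

Import Order.TTheory GRing.Theory Num.Theory.
Local Open Scope ring_scope.
Local Open Scope fset_scope.

Record sgraph (V : choiceType) := SGraph {
  edge : rel V;
  edge_sym : symmetric edge;
  edge_irr : irreflexive edge }.

Section Graph.
Variables (V : choiceType) (G : sgraph V).

(* The vertices of the path are u :: p, so its length is size p. *)
Definition is_gpath (u v : V) (p : seq V) : Prop :=
  [/\ path (edge G) u p, last u p = v & uniq (u :: p)].

Definition induces_connected (A : {pred V}) : Prop :=
  forall u v, u \in A -> v \in A ->
    exists2 p, is_gpath u v p & {subset p <= A}.

Definition gconnected : Prop := induces_connected predT.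

Definition has_gpath_of_length (u v : V) : pred nat :=
  fun n => `[< exists2 p, is_gpath u v p & size p = n >].

(* The value 0 when no path exists is a junk value; it does not arise for
   connected graphs. *)
Definition gdist (u v : V) : nat :=
  if pselect (exists n, has_gpath_of_length u v n) is left h
  then ex_minn h else 0%N.

Variable R : realType.

Definition weight_distribution (w : V -> R) : Prop := forall x, 0 <= w x.

Definition weight (w : V -> R) (T : {fset V}) : R := \sum_(x <- T) w x.

Definition sharing_move (T : {fset V}) (w w' : V -> R) : Prop :=
  [/\ T != fset0,
      induces_connected (mem T),
      forall x, x \in T -> w' x = weight w T / #|` T|%:R
    & forall x, x \notin T -> w' x = w x].

Definition edge_sharing_move (w w' : V -> R) : Prop :=
  exists x y, edge G x y /\ sharing_move [fset x; y] w w'.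

Inductive edge_reachable (w : V -> R) : (V -> R) -> Prop :=
| edge_reachable_refl : edge_reachable w w
| edge_reachable_step w1 w2 :
    edge_reachable w w1 -> edge_sharing_move w1 w2 -> edge_reachable w w2.

End Graph.

(* Main.v *)
(** Write [d x] for the distance from [r] to [x].  The bound on a single vertex
    is not preserved by sharing moves, but the following bound on all finite
    sets [S] at once is: [w(S) <= 1 - \prod_(x in S) d x / (d x + 1)].  If a
    move on an edge [xy] changes [w(S)], say with [x] in [S] and [y] not in [S],
    then the new value is the mean of [w(S - x)] and [w(S + y)], and the bounds
    for these two sets average to at most the bound for [S], because
    [d y >= d x - 1].  The theorem is the case [S = {v}]. *)
Require Import Defs.
From mathcomp Require Import all_boot all_order all_algebra finmap.
From mathcomp Require Import boolp classical_sets reals numfun.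
From mathcomp Require Import ring lra.

Set Implicit Arguments.
Unset Strict Implicit.
Unset Printing Implicit Defensive.

Import Order.TTheory GRing.Theory Num.Theory.
Local Open Scope ring_scope.
Local Open Scope classical_set_scope.

Section Distance.
Variables (V : choiceType) (G : sgraph V).

(** The walk [p] may repeat vertices; cutting out its loops leaves a path that is no longer, and
    [gdist] is a minimum over paths. *)
Lemma gdist_le_size (u : V) (p : seq V) :
  path (edge G) u p -> (gdist G u (last u p) <= size p)%N.
Proof.
move=> Gp; rewrite /gdist; case: pselect => // h.
case: ex_minnP => n _; case/shortenP: Gp => q Gq uq /uniq_leq_size le_qp.
have /le_qp {}le_qp : uniq q by case/andP: uq.
by move=> /(_ (size q)) le_n; apply: leq_trans le_qp; apply/le_n/asboolP; exists q.
Qed.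

Lemma gdistxx (u : V) : gdist G u u = 0%N.
Proof. by apply/eqP; rewrite -leqn0; exact: (@gdist_le_size u [::]). Qed.

Hypothesis connG : gconnected G.

(** Connectedness excludes the junk value of [gdist], so the minimum is taken over a nonempty set of
    lengths. *)
Lemma gdist_attained (u v : V) : exists2 p, is_gpath G u v p & size p = gdist G u v.
Proof.
rewrite /gdist; case: pselect => [h|[]]; first by case: ex_minnP => n /asboolP.
by have [p Gp _] := @connG u v isT isT; exists (size p); apply/asboolP; exists p.
Qed.

(** Append [y] to a shortest path to [x]. The result may already pass through [y], hence the bound
    by walks above. *)
Lemma gdist_edge (u x y : V) : edge G x y -> (gdist G u y <= (gdist G u x).+1)%N.
Proof.
move=> Gxy; have [p [Gp px _] <-] := gdist_attained u x.
rewrite -(size_rcons p y) -[y in gdist G u y](last_rcons u p).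
by apply: gdist_le_size; rewrite rcons_path Gp px.
Qed.

End Distance.

Local Open Scope fset_scope.
Local Open Scope ring_scope.

Section Weight.
Variables (V : choiceType) (R : realType).
Implicit Types (w : V -> R) (S : {fset V}) (x y : V).

Lemma weight_fset1 w x : weight w [fset x] = w x.
Proof. by rewrite /weight big_seq_fset1. Qed.

Lemma weight_fsetU1 w x S : x \notin S -> weight w (x |` S) = w x + weight w S.
Proof. by move=> xS; rewrite /weight big_fsetU1. Qed.

Lemma weight_fsetD1 w x S : x \in S -> weight w S = w x + weight w (S `\ x).
Proof. by move=> xS; rewrite /weight (big_fsetD1 x). Qed.

Lemma eq_in_weight w w' S : {in S, w =1 w'} -> weight w S = weight w' S.
Proof. by move=> ww'; rewrite /weight; apply: eq_big_seq. Qed.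

Lemma edge_sharing_moveP (G : sgraph V) w w' : edge_sharing_move G w w' ->
  exists x y, [/\ edge G x y, x != y, w' x = (w x + w y) / 2,
    w' y = (w x + w y) / 2 & forall z, z != x -> z != y -> w' z = w z].
Proof.
move=> [x [y [Gxy [_ _ w'T w'N]]]].
(* Since there are no loops, the shared set has exactly two elements, so the denominator is 2. *)
have xy : x != y by apply: contraTneq Gxy => ->; rewrite edge_irr.
have wT : weight w [fset x; y] / #|` [fset x; y]|%:R = (w x + w y) / 2.
  by rewrite weight_fsetU1 ?inE // weight_fset1 cardfs2 xy.
exists x, y; split=> // [||z zx zy].
- by rewrite w'T ?wT // !inE eqxx.
- by rewrite w'T ?wT // !inE eqxx orbT.
- by rewrite w'N // !inE negb_or zx.
Qed.

End Weight.

Section ProductBound.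
Variables (V : choiceType) (R : realType) (d : V -> nat).
Implicit Types (w : V -> R) (S : {fset V}).

(** What the bound on [S] leaves of the total weight 1. It vanishes as soon as [S] contains a vertex
    with [d x = 0]. *)
Definition slack S : R := \prod_(x <- S) ((d x)%:R / (d x).+1%:R).

Definition product_bounded w := forall S, weight w S <= 1 - slack S.

Lemma slack_fsetU1 x S :
  x \notin S -> slack (x |` S) = (d x)%:R / (d x).+1%:R * slack S.
Proof. by move=> xS; rewrite /slack big_fsetU1. Qed.

Lemma slack_fsetD1 x S :
  x \in S -> slack S = (d x)%:R / (d x).+1%:R * slack (S `\ x).
Proof. by move=> xS; rewrite /slack (big_fsetD1 x). Qed.

Lemma slack_ge0 S : 0 <= slack S.
Proof. by apply: prodr_ge0 => x _; rewrite divr_ge0. Qed.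

Lemma slack_le1 S : slack S <= 1.
Proof.
by apply: prodr_ile1 => x _; rewrite divr_ge0 //= ler_pdivrMr ?ltr0n // mul1r ler_nat.
Qed.

(** The averaging of the bounds, with the common factor [slack (S - x)] divided out, for [m = d x]
    and [n = d y]. The difference of the two sides is [(n + 1 - m) / (2 (n + 1) (m + 1))], so its
    sign is exactly the condition [m <= n + 1]. *)
Lemma ratio_mean_le (m n : nat) : (m <= n.+1)%N ->
  m%:R / m.+1%:R <= (1 + n%:R / n.+1%:R * (m%:R / m.+1%:R)) / 2 :> R.
Proof.
move=> le_mn.
have m1 : 0 < m.+1%:R :> R by rewrite ltr0n.
have n1 : 0 < n.+1%:R :> R by rewrite ltr0n.
have mn : m%:R <= n.+1%:R :> R by rewrite ler_nat.
rewrite -subr_ge0.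
have -> : (1 + n%:R / n.+1%:R * (m%:R / m.+1%:R)) / 2 - m%:R / m.+1%:R
    = (n.+1%:R - m%:R) / (2 * n.+1%:R * m.+1%:R) :> R.
  rewrite -[n.+1]addn1 -[m.+1]addn1 !natrD in m1 n1 *.
  by field; rewrite !gt_eqF.
by apply: divr_ge0; rewrite ?subr_ge0 // !mulr_ge0 // ltW.
Qed.

Lemma product_bounded_separating w x y S :
    product_bounded w -> (d x <= (d y).+1)%N -> x \in S -> y \notin S ->
  (w x + w y) / 2 + weight w (S `\ x) <= 1 - slack S.
Proof.
move=> wB dxy xS yS; have := wB (S `\ x); have := wB (y |` S).
rewrite weight_fsetU1 // slack_fsetU1 // (weight_fsetD1 w xS) (slack_fsetD1 xS).
have := ler_wpM2r (slack_ge0 (S `\ x)) (ratio_mean_le dxy).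
(* Half the sum of the bounds for [S + y] and [S - x] is [1 - (1 + b * a) / 2 * s], which is at most
   [1 - a * s] by the previous inequality. *)
move: (_ / (d x).+1%:R) (_ / (d y).+1%:R) (slack _) (weight _ _) => a b s t.
nra.
Qed.

(** A move with both or neither of its ends in [S] keeps the weight of [S]. The two separating cases
    are symmetric and use the Lipschitz condition on [d] in opposite directions along the edge. *)
Lemma product_bounded_step (G : sgraph V) w w' :
    (forall x y, edge G x y -> (d y <= (d x).+1)%N) ->
  product_bounded w -> edge_sharing_move G w w' -> product_bounded w'.
Proof.
move=> dG wB /edge_sharing_moveP[x [y [Gxy xy w'x w'y w'N]]] S.
have dyx := dG _ _ Gxy.
have dxy : (d x <= (d y).+1)%N by apply: dG; rewrite edge_sym.
have w'S (T : {fset V}) : x \notin T -> y \notin T -> weight w' T = weight w T.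
  move=> xT yT; apply: eq_in_weight => z zT.
  by apply: w'N; apply: contraTneq zT => ->.
have [xS|xS] := boolP (x \in S); have [yS|yS] := boolP (y \in S).
- have ySx : y \in S `\ x by rewrite !inE eq_sym xy.
  have := wB S; rewrite !(weight_fsetD1 _ xS) !(weight_fsetD1 _ ySx).
  rewrite w'S ?inE ?eqxx ?andbF // w'x w'y; lra.
- rewrite (weight_fsetD1 _ xS) w'x w'S ?inE ?eqxx ?(negPf yS) ?andbF //.
  exact: product_bounded_separating.
- rewrite (weight_fsetD1 _ yS) w'y w'S ?inE ?eqxx ?(negPf xS) ?andbF //.
  by rewrite [w x + _]addrC; apply: product_bounded_separating.
- by rewrite w'S.
Qed.

(** If [r] lies in [S], the factor of [r] makes the slack 0 and the bound 1, which is attained;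
    otherwise [S] has weight 0. *)
Lemma product_bounded_indic (r : V) :
  d r = 0%N -> product_bounded (\1_[set r]%classic : V -> R).
Proof.
move=> dr S.
have indicN T : r \notin T -> weight (\1_[set r]%classic : V -> R) T = 0.
  move=> rT; rewrite /weight big_seq big1 // => x xT.
  by rewrite indicE memNset //= => xr; move: rT; rewrite -xr xT.
have [rS|rS] := boolP (r \in S).
  rewrite (weight_fsetD1 _ rS) indicN ?inE ?eqxx // (slack_fsetD1 rS) dr.
  by rewrite indicE mem_set //= !mul0r subr0 addr0.
by rewrite indicN // subr_ge0 slack_le1.
Qed.

Lemma product_bounded_reachable (G : sgraph V) w w' :
    (forall x y, edge G x y -> (d y <= (d x).+1)%N) ->
  product_bounded w -> edge_reachable G w w' -> product_bounded w'.
Proof.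
move=> dG wB; elim=> // w1 w2 _ w1B.
exact: product_bounded_step.
Qed.

(** For a singleton the bound is [1 - n / (n + 1) = 1 / (n + 1)] with [n = d v]. *)
Lemma product_bounded_vertex w v : product_bounded w -> w v <= (d v).+1%:R^-1.
Proof.
move=> /(_ [fset v]); rewrite weight_fset1 /slack big_seq_fset1 => /le_trans; apply.
rewrite -[X in X - _](@divff _ (d v).+1%:R) ?pnatr_eq0 // -mulrBl.
by rewrite -natrB // subSnn mul1r.
Qed.

End ProductBound.

Local Open Scope classical_set_scope.

Theorem theorem1p1 (R : realType) (V : choiceType) (G : sgraph V)
    (hG : gconnected G) (r v : V) (w : V -> R)
    (hw : weight_distribution w)
    (hreach : edge_reachable G (\1_[set r] : V -> R) w) :
  w v <= 1 / (gdist G r v + 1)%:R.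
Proof.
rewrite div1r addn1; apply: (product_bounded_vertex (d := gdist G r)).
apply: product_bounded_reachable hreach => [x y|]; first exact: gdist_edge.
exact/product_bounded_indic/gdistxx.
Qed.
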